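(* For $t\in\{\mathrm{i},\mathrm{f}\}$, the ergodic communication rates $\mathcal{R}_t^{\mathrm{N}}$ and $\mathcal{R}_t^{\mathrm{F}}$ of the near user and the far user are given by $$\mathcal{R}_t^{\mathrm{N}}=\frac{\kappa_t}{\ln 2}\left(\psi_{t,3}-\psi_{t,2}-\psi_{t,1}\right),\qquad \mathcal{R}_t^{\mathrm{F}}=\frac{\kappa_t}{\ln 2}\psi_{t,3}-\frac{\kappa_t}{\ln 2}\,\mathrm{Ei}\!\left(-\chi_{t,3}/p\right)e^{\frac{\chi_{t,3}}{p}},$$ respectively, where $\mathrm{Ei}(\cdot)$ is the exponential integral, $\psi_{t,b}=\mathrm{Ei}\!\left(-\frac{\chi_{t,b}}{\alpha_{\mathrm{N}}p}\right)e^{\frac{\chi_{t,b}}{\alpha_{\mathrm{N}}p}}$, and $\chi_{t,b}=\frac{\kappa_t\sigma_{\mathrm{c}}^2}{\mu_t\varrho_b}$ for $b\in\{1,2,3\}$ with $\varrho_3=\frac{\varrho_1\varrho_2}{\varrho_1+\varrho_2}$. When $p\to\infty$, the ergodic communication rates satisfy $$\mathcal{R}_t^{\mathrm{N}}\approx\kappa_t\log_2p-\frac{\kappa_t\gamma}{\ln2}-\kappa_t\log_2\frac{\kappa_t\sigma_{\mathrm{c}}^2}{\mu_t\alpha_{\mathrm{N}}(\varrho_1+\varrho_2)},\qquad \mathcal{R}_t^{\mathrm{F}}\approx-\kappa_t\log_2\alpha_{\mathrm{N}},$$ where $\gamma$ is the Euler–Mascheroni constant.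
   Context: A base station serves two users by nonorthogonal multiple access (NOMA). Let $h_1\sim\mathcal{CN}(0,\varrho_1)$ and $h_2\sim\mathcal{CN}(0,\varrho_2)$ be mutually independent complex Gaussian random variables with $\varrho_1>0$, $\varrho_2>0$. The near user (N) and the far user (F) have channel coefficients with $|h_{\mathrm{N}}|=\max\{|h_1|,|h_2|\}$ and $|h_{\mathrm{F}}|=\min\{|h_1|,|h_2|\}$. Let $p$ be the power budget, $\sigma_{\mathrm{c}}^2$ the communication noise variance, and $\alpha_{\mathrm{N}},\alpha_{\mathrm{F}}$ power allocation factors with $\alpha_{\mathrm{N}}+\alpha_{\mathrm{F}}=1$ and $\alpha_{\mathrm{N}}<\alpha_{\mathrm{F}}$. The index $t=\mathrm{i}$ denotes integrated sensing and communications (ISAC), with $\kappa_{\mathrm{i}}=\mu_{\mathrm{i}}=1$; the index $t=\mathrm{f}$ denotes frequency-division sensing and communications (FDSAC), with $\kappa_{\mathrm{f}}=\kappa$ and $\mu_{\mathrm{f}}=\mu$, where $\kappa\in[0,1]$ and $\mu\in[0,1]$ are the fractions of the bandwidth and of the power used for communications. Define $$\gamma_t^{\mathrm{N}}=\frac{\mu_t p|h_{\mathrm{N}}|^2\alpha_{\mathrm{N}}}{\kappa_t\sigma_{\mathrm{c}}^2},\qquad \gamma_t^{\mathrm{F}}=\frac{\mu_t p|h_{\mathrm{F}}|^2\alpha_{\mathrm{F}}}{\kappa_t\sigma_{\mathrm{c}}^2+\mu_t p|h_{\mathrm{F}}|^2\alpha_{\mathrm{N}}}.$$ The ergodic communication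 rates are $\mathcal{R}_t^{\mathrm{N}}=\mathbb{E}\{\kappa_t\log_2(1+\gamma_t^{\mathrm{N}})\}$ and $\mathcal{R}_t^{\mathrm{F}}=\mathbb{E}\{\kappa_t\log_2(1+\gamma_t^{\mathrm{F}})\}$. The symbol $\approx$ denotes a high-SNR ($p\to\infty$) approximation with all other parameters fixed. For $x>0$, $\mathrm{Ei}(-x)=-\int_x^\infty\frac{e^{-u}}{u}\,du$. *)

(* Defs.v *)
From HB Require Import structures.
From mathcomp Require Import all_boot all_order all_algebra.
From mathcomp Require Import all_classical all_reals all_analysis.
From mathcomp Require Import complex.

Set Implicit Arguments.
Unset Strict Implicit.
Unset Printing Implicit Defensive.

Import Order.TTheory GRing.Theory Num.Theory numFieldNormedType.Exports.

Local Open Scope classical_set_scope.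
Local Open Scope ring_scope.

Section RandomVariables.
Context (d : measure_display) (T : measurableType d) (R : realType).
Variable P : probability T R.

Definition has_law (X : T -> R) (Q : set (measurableTypeR R) -> \bar R) : Prop :=
  measurable_fun setT X /\ forall A, measurable A -> P (X @^-1` A) = Q A.

Definition independent_rv (d1 d2 : measure_display)
    (T1 : measurableType d1) (T2 : measurableType d2)
    (X : T -> T1) (Y : T -> T2) : Prop :=
  forall A B, measurable A -> measurable B ->
    P (X @^-1` A `&` Y @^-1` B) = (P (X @^-1` A) * P (Y @^-1` B))%E.

(* [R[i]] carries no sigma-algebra in the library: its Borel sets are those of
   the product [R * R]. *)
Definition coords (h : T -> R[i]) (w : T) : measurableTypeR R * measurableTypeR R :=
  (@complex.Re R (h w), @complex.Im R (h w)).

(* CN(0, v), circularly symmetric: the total variance [v] is split evenly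
   between the independent real and imaginary parts.  The second parameter of
   [normal_prob] is the standard deviation. *)
Definition complex_gaussian (h : T -> R[i]) (v : R) : Prop :=
  [/\ has_law (@complex.Re R \o h) (normal_prob 0 (Num.sqrt (v / 2))),
      has_law (@complex.Im R \o h) (normal_prob 0 (Num.sqrt (v / 2))) &
      independent_rv (@complex.Re R \o h : T -> measurableTypeR R)
                     (@complex.Im R \o h : T -> measurableTypeR R)].

End RandomVariables.

Section SpecialFunctions.
Context (R : realType).

Definition log2 (x : R) : R := ln x / ln 2.

(* Meaningful for y < 0 only. *)
Definition Ei (y : R) : R :=
  - \int[lebesgue_measure]_(u in `]- y, +oo[) (expR (- u) / u).

Definition euler_mascheroni : R :=
  limn (fun n : nat => \sum_(1 <= k < n.+1) (k%:R)^-1 - ln n%:R : R).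

End SpecialFunctions.

Variant scheme := ISAC | FDSAC.

Definition kappa_of (R : realType) (kappa : R) (t : scheme) : R :=
  if t is FDSAC then kappa else 1.

Definition mu_of (R : realType) (mu : R) (t : scheme) : R :=
  if t is FDSAC then mu else 1.

(* In this section [kappa] and [mu] stand for kappa_t and mu_t, and [sigma2] for
   the noise variance.  Division by zero returns zero, so that the two rates are
   0 when kappa = 0, which is also their limit as kappa tends to 0. *)
Section Rates.
Context (R : realType).
Variables (kappa mu sigma2 : R).

Definition snr_near (alphaN p : R) (h : R[i]) : R :=
  mu * p * Normc.normc h ^+ 2 * alphaN / (kappa * sigma2).

Definition sinr_far (alphaN alphaF p : R) (h : R[i]) : R :=
  mu * p * Normc.normc h ^+ 2 * alphaF / (kappa * sigma2 + mu * p * Normc.normc h ^+ 2 * alphaN).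

Definition rate_near (d : measure_display) (T : measurableType d)
    (P : probability T R) (alphaN : R) (hN : T -> R[i]) (p : R) : \bar R :=
  'E_P[(fun w => kappa * log2 (1 + snr_near alphaN p (hN w)))%R]%E.

Definition rate_far (d : measure_display) (T : measurableType d)
    (P : probability T R) (alphaN alphaF : R) (hF : T -> R[i]) (p : R) : \bar R :=
  'E_P[(fun w => kappa * log2 (1 + sinr_far alphaN alphaF p (hF w)))%R]%E.

Definition chi (rho : R) : R := kappa * sigma2 / (mu * rho).

Definition psi (alphaN p rho : R) : R :=
  Ei (- (chi rho / (alphaN * p))) * expR (chi rho / (alphaN * p)).

End Rates.

(* Main.v *)
(* For a circular Gaussian [h] of variance [v], the power [|h|^2] is exponential
   of mean [v]: writing [y = |x| t] in the double integral of the Gaussian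
   density separates the radius from the slope [t], and the angular constant is
   fixed by the total mass being 1.  The smaller of two independent powers is
   then exponential of mean [rho3], and
     [ln (1 + a max(X, Y)) = ln (1 + a X) + ln (1 + a Y) - ln (1 + a min(X, Y))]
   reduces both rates to the mean of [ln (1 + a V)] for an exponential [V],
   which is an exponential integral by the tail formula and the substitution
   [r = ln u - ln x].

   The high-SNR limits come from [-x <= Ei(-x) - ln x - gamma <= 0].  Put
     [K_n(x) = \sum_(k = 1 .. n) (1 - (1 - x/n)^k) / k],
   so that [K_n(n)] is the harmonic number, [0 <= K_n(x) <= x] and
   [K_n'(x) = (1 - (1 - x/n)^n) / x].  Then [- Ei(-x) + ln x - K_n(x)] has
   derivative [((1 - x/n)^n - e^-x) / x], which lies between [- x e^-x / n] and
   0, so its values at [x] and [n] differ by at most [1/n]; let [n] tend to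
   infinity. *)

From HB Require Import structures.
Require Import Defs.
From mathcomp Require Import all_boot all_order all_algebra.
From mathcomp Require Import all_classical all_reals all_analysis.
From mathcomp Require Import measurable_realfun.
From mathcomp Require Import complex.
From mathcomp Require Import ring lra.

Set Implicit Arguments.
Unset Strict Implicit.
Unset Printing Implicit Defensive.

Import Order.TTheory GRing.Theory Num.Theory numFieldNormedType.Exports.
Local Open Scope classical_set_scope.
Local Open Scope ring_scope.

(** * Integration against a normal law, scaling and evenness of Lebesgue integrals *)

Section lebesgue_change_of_variables.
Context (R : realType).
Local Notation mu := (@lebesgue_measure R).
Local Open Scope ereal_scope.

(** The normal law is absolutely continuous, and its Radon-Nikodym derivative equals the density
    almost everywhere because both have the same integral over every measurable set. *)
Lemma integral_normal_prob (s : R) (f : measurableTypeR R -> \bar R) :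
  (normal_prob 0 s).-integrable [set: R] f ->
  \int[normal_prob 0 s]_x f x = \int[mu]_x (f x * (normal_pdf 0 s x)%:E).
Proof.
move=> intf.
have mf : measurable_fun setT f by exact: (measurable_int (normal_prob 0 s)).
have dom := @normal_prob_dominates R 0 s.
rewrite -(Radon_Nikodym_change_of_variables dom)//=.
apply: ae_eq_integral => //.
- exact: emeasurable_funM.
- apply: emeasurable_funM => //; apply/measurable_EFinP.
  exact: measurable_normal_pdf.
- apply: ae_eqe_mul2l => /=.
  rewrite Radon_NikodymE//=.
  case: cid => /= h [h1 h2 h3].
  apply: integral_ae_eq => //=.
  + by apply/measurable_EFinP; exact: (measurable_normal_pdf 0 s).
  + by move=> E E01 mE; rewrite -h3.
Qed.

(** The image of Lebesgue measure under [x |-> k x], multiplied by [k], gives each half-open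
    interval its length, so it is Lebesgue measure by uniqueness. *)
Lemma ge0_integral_scale (k : R) (f : measurableTypeR R -> \bar R) : (0 < k)%R ->
  measurable_fun setT f -> (forall x, 0 <= f x) ->
  \int[mu]_x f x = k%:E * \int[mu]_x f (k * x)%R.
Proof.
move=> k0 mf f0.
have mk : measurable_fun setT (fun x : R => (k * x)%R : measurableTypeR R).
  exact: measurable_funM.
rewrite -[in RHS](_ : \int[pushforward mu (fun x : R => (k * x)%R : measurableTypeR R)]_y f y
  = \int[mu]_x f (k * x)%R); last first.
  by rewrite ge0_integral_pushforward//= preimage_setT.
rewrite -(@ge0_integral_mscale _ _ _ _ setT measurableT (NngNum (ltW k0)))//.
apply: eq_measure_integral => A mA _.
apply: lebesgue_measure_unique => // _ [[a b]] _ <-.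
transitivity (k%:E * mu `](a / k)%R, (b / k)%R]%classic); last first.
  congr (_ * mu _); apply/seteqP.
  by split => x/=; rewrite !in_itv/= ltr_pdivrMr// ler_pdivlMr// mulrC.
rewrite !lebesgue_measure_itv/= !lte_fin ltr_pM2r ?invr_gt0//.
case: ifPn => _; last by rewrite mule0.
by rewrite -EFinB -EFinM; congr EFin; field; rewrite gt_eqF.
Qed.

Lemma ge0_even_integral (f : R -> \bar R) : measurable_fun setT f ->
  (forall x, 0 <= f x) -> (forall x, f (- x)%R = f x) ->
  \int[mu]_x f x = 2%:E * \int[mu]_(x in `[0%R, +oo[) f x.
Proof.
move=> mf f0 fN.
rewrite -(setUv `[0%R, +oo[%classic) ge0_integral_setU//=; last 3 first.
- exact: measurableC.
- by rewrite setUv.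
- by rewrite disj_set2E setICr.
rewrite setCitvr.
rewrite -[X in _ + X](_ : \int[mu]_(x in `]-oo, 0%R]) f x = _); last first.
  apply/esym; rewrite integral_itv_bndo_bndc//; exact: measurable_funTS.
rewrite -[X in _ + X](_ : \int[mu]_(x in `[0%R, +oo[) f x = _).
  by rewrite mule_natl mule2n.
by rewrite ge0_integration_by_substitution0//; apply: eq_integral => x _; rewrite fN.
Qed.

End lebesgue_change_of_variables.

(** * Double integrals of radial functions *)

Section radial_integral.
Context (R : realType).
Local Notation mu := (@lebesgue_measure R).
Local Open Scope ereal_scope.

(* Polar coordinates in disguise: substitute [y = |x| t], exchange the order,
   then rescale [x] by [sqrt (1 + t ^+ 2)]. *)
Lemma radial_integral (h : R -> R) : measurable_fun setT h ->
  (forall u, 0 <= h u)%R ->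
  \int[mu]_x \int[mu]_y (h (x ^+ 2 + y ^+ 2)%R)%:E =
  (\int[mu]_t ((1 + t ^+ 2)^-1)%:E) * \int[mu]_x (`|x| * h (x ^+ 2))%:E.
Proof.
move=> mh h0.
have m2 : measurable_fun setT (fun p : measurableTypeR R * measurableTypeR R =>
    (h (p.1 ^+ 2 + p.2 ^+ 2))%:E).
  apply/measurable_EFinP; apply: measurableT_comp => //.
  by apply: measurable_funD; apply: measurable_funX.
have mxt : measurable_fun setT (fun p : measurableTypeR R * measurableTypeR R =>
    (`|p.1| * h (p.1 ^+ 2 * (1 + p.2 ^+ 2)))%:E).
  apply/measurable_EFinP; apply: measurable_funM.
    exact: measurableT_comp.
  apply: measurableT_comp => //; apply: measurable_funM.
    exact: measurable_funX.
  by apply: measurable_funD => //; apply: measurable_funX.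
have mx : measurable_fun [set: measurableTypeR R] (fun x => (`|x| * h (x ^+ 2))%:E).
  apply/measurable_EFinP; apply: measurable_funM; first exact: normr_measurable.
  by apply: measurableT_comp => //; apply: measurable_funX.
transitivity (\int[mu]_x \int[mu]_t (`|x| * h (x ^+ 2 * (1 + t ^+ 2)))%:E).
  apply: ge0_ae_eq_integral => //.
  - by apply: (measurable_fun_fubini_tonelli_F _ m2) => p; rewrite lee_fin.
  - by apply: (measurable_fun_fubini_tonelli_F _ mxt) => p; rewrite lee_fin mulr_ge0.
  - by move=> x _; apply: integral_ge0 => y _; rewrite lee_fin.
  - by move=> x _; apply: integral_ge0 => y _; rewrite lee_fin mulr_ge0.
  (* Scaling the inner integral by [|x|] requires [x != 0]; the excluded point is a null set. *)
  - exists [set 0%R]; split => //; first exact: lebesgue_measure_set1.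
    move=> x/=; apply: contra_notP => /eqP x0 _.
    rewrite (@ge0_integral_scale _ `|x|%R) ?normr_gt0//; last 2 first.
    + apply/measurable_EFinP; apply: measurableT_comp => //.
      by apply: measurable_funD => //; apply: measurable_funX.
    + by move=> y; rewrite lee_fin.
    rewrite -ge0_integralZl//.
    + apply: eq_integral => t _; rewrite -EFinM; congr (_ * h _)%:E.
      by rewrite exprMn real_normK ?num_real//; ring.
    + apply/measurable_EFinP; apply: measurableT_comp => //.
      apply: measurable_funD => //; apply: measurable_funX.
      exact: measurable_funM.
    + by move=> t _; rewrite lee_fin.
rewrite (@fubini_tonelli _ _ _ _ _ _ _ _ mxt)/=; last first.
  by move=> x; rewrite lee_fin mulr_ge0.
rewrite -ge0_integralZr//; last 3 first.
- apply/measurable_EFinP; apply: measurable_funTS.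
  by apply: continuous_measurable_fun; exact: continuous_oneDsqrV.
- by move=> t _; rewrite lee_fin invr_ge0 addr_ge0// sqr_ge0.
- by apply: integral_ge0 => x _; rewrite lee_fin mulr_ge0.
apply: eq_integral => t _.
have t1 : (0 < 1 + t ^+ 2 :> R)%R by rewrite ltr_wpDr// sqr_ge0.
pose k := Num.sqrt (1 + t ^+ 2)%R.
have k0 : (0 < k)%R by rewrite sqrtr_gt0.
rewrite (@ge0_integral_scale _ k _ k0 mx); last by move=> x; rewrite lee_fin mulr_ge0.
rewrite muleA -EFinM -ge0_integralZl//; last 3 first.
- apply/measurable_EFinP; apply: measurable_funM.
    by apply: measurableT_comp => //; exact: measurable_funM.
  apply: measurableT_comp => //; apply: measurable_funX.
  exact: measurable_funM.
- by move=> x _; rewrite lee_fin mulr_ge0.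
- by rewrite lee_fin; apply: mulr_ge0; [rewrite invr_ge0 ltW|exact: ltW].
apply: eq_integral => x _; rewrite -EFinM; congr EFin.
rewrite exprMn normrM (gtr0_norm k0) sqr_sqrtr ?ltW// [(x ^+ 2 * _)%R]mulrC.
rewrite -!mulrA [(k * (k * _))%R]mulrA -expr2 sqr_sqrtr ?ltW//.
by rewrite mulKf// gt_eqF.
Qed.

End radial_integral.

(** * The squared radius under a product of two equal centred normal laws *)

Section complex_gaussian_law.
Context (R : realType).
Local Notation mu := (@lebesgue_measure R).
Local Open Scope ereal_scope.

(** By evenness this is twice the integral over [x > sqrt z], where the integrand [x exp(-x^2/v)]
    has antiderivative [-(v/2) exp(-x^2/v)]. *)
Lemma integral_radial_tail (v z : R) : (0 < v)%R -> (0 <= z)%R ->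
  \int[mu]_x (`|x| * (\1_`]z, +oo[ (x ^+ 2) * expR (- (x ^+ 2 / v))))%:E
  = (v * expR (- (z / v)))%:E.
Proof.
move=> v0 z0; rewrite ge0_even_integral//; last 2 first.
- apply/measurable_EFinP; apply: measurable_funM; first exact: normr_measurable.
  apply: measurable_funM.
    by apply: measurableT_comp => //; apply: measurable_funX.
  apply: measurableT_comp => //; apply: measurableT_comp => //.
  by apply: measurable_funM => //; apply: measurable_funX.
- by move=> x; rewrite normrN sqrrN.
pose s := Num.sqrt z.
transitivity (2%:E * \int[mu]_(x in `[s, +oo[) (x * expR (- (x ^+ 2 / v)))%:E).
  congr (_ * _).
  rewrite -[RHS]integral_itv_obnd_cbnd; last first.
    apply/measurable_EFinP; apply: measurable_funTS; apply: measurable_funM => //.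
    apply: measurableT_comp => //; apply: measurableT_comp => //.
    by apply: measurable_funM => //; apply: measurable_funX.
  rewrite integral_mkcond [RHS]integral_mkcond; apply: eq_integral => x _.
  rewrite !patchE !mem_setE !in_itv/= !andbT.
  have [x0|x0] := leP 0%R x; last first.
    by rewrite ifF//; apply/negbTE; rewrite -leNgt (le_trans (ltW x0))// sqrtr_ge0.
  rewrite indicE mem_setE in_itv/= andbT.
  rewrite (_ : (z < x ^+ 2)%R = (s < x)%R).
    by case: ifPn => _; rewrite ?mul0r ?mulr0// mul1r ger0_norm.
  by rewrite -[in LHS](sqr_sqrtr z0) ltr_pXn2r// nnegrE sqrtr_ge0.
rewrite (@ge0_continuous_FTC2y _ (fun x => x * expR (- (x ^+ 2 / v)))
  (fun x => - (v / 2 * expR (- (x ^+ 2 / v)))) s (- (v / 2 * 0)))%R/=.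
- rewrite -EFinB -EFinM; congr EFin.
  by rewrite sqr_sqrtr//; field.
- by move=> x sx; rewrite mulr_ge0 ?expR_ge0// (le_trans _ sx)// sqrtr_ge0.
- apply: continuous_subspaceT => x; apply: cvgM => //.
  apply: continuous_comp; last exact: continuous_expR.
  apply: cvgN; apply: cvgMr_tmp; exact: exprn_continuous.
- apply: cvgN; apply: cvgMl_tmp.
  apply: (cvg_comp (fun x => x ^+ 2 / v)%R (fun x => expR (- x))); last exact: cvgr_expR.
  by apply: gt0_cvgMly; [rewrite invr_gt0|exact: cvgr_expr2].
- by move=> x _; apply: ex_derive.
- apply: cvg_at_right_filter; apply: cvgN; apply: cvgMl_tmp.
  apply: continuous_comp; last exact: continuous_expR.
  apply: cvgN; apply: cvgMr_tmp; exact: exprn_continuous.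
- move=> x _; rewrite derive1E; apply: derive_val; apply: is_derive_eq.
  by rewrite /GRing.scale/=; field; rewrite gt_eqF.
Qed.

(** The joint density at [(x, y)] depends on [x^2 + y^2] only, so [radial_integral] applies to the
    density times the indicator of [B]. The angular factor is left as an integral: only its
    independence of [B] matters. *)
Lemma gaussian_radial_measure (v : R) (B : set R) : (0 < v)%R -> measurable B ->
  let N := normal_prob 0 (Num.sqrt (v / 2)) in
  (N \x N)%E [set p | B (p.1 ^+ 2 + p.2 ^+ 2)%R] =
  (\int[mu]_t ((1 + t ^+ 2)^-1)%:E) * ((normal_peak (Num.sqrt (v / 2)) ^+ 2)%:E *
  \int[mu]_x (`|x| * (\1_B (x ^+ 2) * expR (- (x ^+ 2 / v))))%:E).
Proof.
move=> v0 mB N.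
set s := Num.sqrt (v / 2); pose c := normal_peak s.
have s0 : s != 0%R by rewrite gt_eqF// sqrtr_gt0 divr_gt0.
have s2 : (s ^+ 2 = v / 2)%R by rewrite sqr_sqrtr// divr_ge0// ltW.
have pdfE x : normal_pdf 0 s x = (c * expR (- (x ^+ 2 / v)))%R.
  rewrite normal_pdfE//= /normal_fun subr0 s2 mulNr.
  by congr (_ * expR (- (_ / _)))%R; field.
pose A := [set p : measurableTypeR R * measurableTypeR R | B (p.1 ^+ 2 + p.2 ^+ 2)%R].
have mA : measurable A.
  have m2 : measurable_fun setT (fun p : measurableTypeR R * measurableTypeR R =>
      (p.1 ^+ 2 + p.2 ^+ 2)%R).
    by apply: measurable_funD; apply: measurable_funX.
  by rewrite -[A]setTI; exact: m2.
pose h u := (c ^+ 2 * (\1_B u * expR (- (u / v))))%R.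
have mh : measurable_fun setT h.
  apply: measurable_funM => //; apply: measurable_funM => //.
  apply: measurableT_comp => //; apply: measurableT_comp => //.
  exact: measurable_funM.
have h0 u : (0 <= h u)%R.
  by apply: mulr_ge0; [exact: sqr_ge0|rewrite indicE mulr_ge0 ?ler0n ?expR_ge0].
have me : measurable_fun [set: measurableTypeR R]
    (fun x => (`|x| * (\1_B (x ^+ 2) * expR (- (x ^+ 2 / v))))%:E).
  apply/measurable_EFinP; apply: measurable_funM; first exact: normr_measurable.
  apply: measurable_funM.
    by apply: measurableT_comp => //; apply: measurable_funX.
  apply: measurableT_comp => //; apply: measurableT_comp => //.
  by apply: measurable_funM => //; apply: measurable_funX.
transitivity (\int[mu]_x \int[mu]_y (h (x ^+ 2 + y ^+ 2)%R)%:E); last first.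
  rewrite radial_integral//; congr (_ * _).
  rewrite -ge0_integralZl//; last by rewrite lee_fin sqr_ge0.
  by apply: eq_integral => x _; rewrite -EFinM /h mulrCA.
rewrite /product_measure1/= -/A.
(* The measures of the sections are bounded by 1, hence integrable for a probability. *)
rewrite integral_normal_prob; last first.
  apply: (@le_integrable _ _ _ _ setT _ _ (cst 1%E)) => //.
  - exact: measurable_fun_xsection.
  - move=> x _ /=; rewrite gee0_abs// normr1; apply: probability_le1.
    exact: measurable_xsection.
  - exact: finite_measure_integrable_cst.
apply: eq_integral => x _ /=.
rewrite /N /normal_prob -/s muleC -ge0_integralZl//; last 3 first.
- apply/measurable_EFinP; apply: measurable_funTS; exact: measurable_normal_pdf.
- by move=> y _; rewrite lee_fin normal_pdf_ge0.
- by rewrite lee_fin normal_pdf_ge0.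
rewrite integral_mkcond; apply: eq_integral => y _.
rewrite patchE mem_xsection -EFinM !pdfE /h.
rewrite (_ : (_ \in A) = (x ^+ 2 + y ^+ 2 \in B)%R); last first.
  by rewrite /A; apply/idP/idP; rewrite !inE.
rewrite indicE; case: ifPn => _; last by rewrite mul0r mulr0.
  by rewrite mul1r mulrDl opprD expRD; congr EFin; ring.
exact: measurable_xsection.
Qed.

End complex_gaussian_law.

(** * Exponential tails of the channel powers and of their minimum *)

Section fading_power_law.
Context (R : realType).
Local Notation mu := (@lebesgue_measure R).
Local Open Scope ereal_scope.

(** Taking the whole line for [B] shows that the product of the angular factor, the squared peak and
    [v] is 1. This normalises the tail without evaluating the angular integral. *)
Lemma gaussian_radial_tail (v z : R) : (0 < v)%R -> (0 <= z)%R ->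
  let N := normal_prob 0 (Num.sqrt (v / 2)) in
  (N \x N)%E [set p | z < p.1 ^+ 2 + p.2 ^+ 2]%R = (expR (- (z / v)))%:E.
Proof.
move=> v0 z0 N; set c2 := (normal_peak (Num.sqrt (v / 2)) ^+ 2)%R.
have tailE y : (0 <= y)%R -> (N \x N)%E [set p | y < p.1 ^+ 2 + p.2 ^+ 2]%R =
    (\int[mu]_t ((1 + t ^+ 2)^-1)%:E) * (c2%:E * (v * expR (- (y / v)))%:E).
  move=> y0; rewrite -(integral_radial_tail v0 y0).
  have mB : measurable `]y, +oo[%classic by exact: measurable_itv.
  rewrite -[RHS](gaussian_radial_measure v0 mB).
  congr (product_measure1 _ _ _).
  by apply/seteqP; split => p/=; rewrite in_itv/= andbT.
have total1 : (\int[mu]_t ((1 + t ^+ 2)^-1)%:E) * (c2%:E * v%:E) = 1.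
  have <- : (N \x N)%E [set p | [set: R] (p.1 ^+ 2 + p.2 ^+ 2)%R] = 1.
    rewrite (_ : [set p | _] = setT `*` setT).
      by rewrite product_measure1E//= /N !probability_setT mule1.
    by apply/seteqP; split.
  rewrite [RHS](gaussian_radial_measure v0 measurableT); congr (_ * (_ * _)).
  have := integral_radial_tail v0 (lexx 0%R).
  rewrite mul0r oppr0 expR0 mulr1 => <-.
  apply: eq_integral => x _; rewrite !indicE in_setT.
  (* The indicators of the whole line and of []0, +oo[] at [x^2] differ only at [x = 0], where the
     factor [|x|] vanishes. *)
  have [->|x0] := eqVneq x 0%R; first by rewrite normr0 !mul0r.
  by rewrite mem_set//= in_itv/= andbT exprn_even_gt0.
by rewrite tailE// [(v * _)%R%:E]EFinM (muleA c2%:E) muleA total1 mul1e.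
Qed.

Lemma normc_sqr (h : R[i]) :
  (Normc.normc h ^+ 2 = @complex.Re R h ^+ 2 + @complex.Im R h ^+ 2)%R.
Proof. by case: h => a b /=; rewrite sqr_sqrtr// addr_ge0// sqr_ge0. Qed.

Lemma measurable_sqr_add :
  measurable_fun setT (fun p : measurableTypeR R * measurableTypeR R =>
    (p.1 ^+ 2 + p.2 ^+ 2)%R).
Proof. by apply: measurable_funD; apply: measurable_funX. Qed.

Lemma measurable_sqr_add_gt (z : R) :
  measurable [set p : measurableTypeR R * measurableTypeR R | z < p.1 ^+ 2 + p.2 ^+ 2]%R.
Proof.
rewrite [X in measurable X](_ : _ = setT `&`
    (fun p : measurableTypeR R * measurableTypeR R =>
      (p.1 ^+ 2 + p.2 ^+ 2)%R) @^-1` `]z, +oo[).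
  exact: measurable_sqr_add.
by rewrite setTI; apply/seteqP; split => p/=; rewrite in_itv/= andbT.
Qed.

Context (d : measure_display) (T : measurableType d) (P : probability T R).

Lemma measurable_coords (h : T -> R[i]) (v : R) : complex_gaussian P h v ->
  measurable_fun setT (coords h).
Proof. by move=> [[mRe _] [mIm _] _]; exact: measurable_fun_pair. Qed.

Lemma measurable_normc_sqr (h : T -> R[i]) (v : R) : complex_gaussian P h v ->
  measurable_fun setT (fun w => Normc.normc (h w) ^+ 2)%R.
Proof.
move=> hv; under eq_fun do rewrite normc_sqr.
exact: measurableT_comp measurable_sqr_add (measurable_coords hv).
Qed.

(** By independence of the real and imaginary parts, the law of [coords h] agrees with the product
    of the marginals on rectangles, hence everywhere by uniqueness of the product measure. *)
Lemma complex_gaussian_tail (h : T -> R[i]) (v z : R) : complex_gaussian P h v ->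
  (0 < v)%R -> (0 <= z)%R ->
  P [set w | z < Normc.normc (h w) ^+ 2]%R = (expR (- (z / v)))%:E.
Proof.
move=> hv v0 z0; have mh := measurable_coords hv.
case: (hv) => -[mRe PRe] [mIm PIm] ind.
pose X : {mfun T >-> (measurableTypeR R * measurableTypeR R)%type} :=
  HB.pack (coords h) (isMeasurableFun.Build _ _ _ _ _ mh).
rewrite -(gaussian_radial_tail v0 z0).
rewrite (@product_measure_unique _ _ _ _ _ _ _ (distribution P X)).
- rewrite /distribution /pushforward; congr (P _).
  by apply/seteqP; split => w/=; rewrite normc_sqr.
- move=> A B mA mB.
  transitivity (P ((@complex.Re R \o h) @^-1` A) * P ((@complex.Im R \o h) @^-1` B)).
    exact: ind.
  by rewrite PRe// PIm.
- exact: measurable_sqr_add_gt.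
Qed.

(** The minimum exceeds [z] exactly when both powers do; by independence the two tails multiply, and
    the rates [1/v1] and [1/v2] add up. *)
Lemma complex_gaussian_tail_min (h1 h2 : T -> R[i]) (v1 v2 z : R) :
  complex_gaussian P h1 v1 -> complex_gaussian P h2 v2 ->
  independent_rv P (coords h1) (coords h2) ->
  (0 < v1)%R -> (0 < v2)%R -> (0 <= z)%R ->
  P [set w | z < Num.min (Normc.normc (h1 w) ^+ 2) (Normc.normc (h2 w) ^+ 2)]%R =
  (expR (- (z / (v1 * v2 / (v1 + v2)))))%:E.
Proof.
move=> hv1 hv2 ind v10 v20 z0.
have := ind _ _ (measurable_sqr_add_gt z) (measurable_sqr_add_gt z).
have preE h : coords h @^-1` [set p | z < p.1 ^+ 2 + p.2 ^+ 2]%R =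
    [set w : T | z < Normc.normc (h w) ^+ 2]%R.
  by apply/seteqP; split => w/=; rewrite normc_sqr.
rewrite !preE (complex_gaussian_tail hv1)// (complex_gaussian_tail hv2)// => {preE}.
rewrite -EFinM -expRD => PE.
transitivity (expR (- (z / v1) - z / v2))%:E.
  rewrite -PE; congr (P _).
  by apply/seteqP; split => w/=; rewrite lt_min => /andP.
congr (expR _)%:E; field.
by rewrite !gt_eqF// addr_gt0.
Qed.

End fading_power_law.

(** * The mean of [ln (1 + a V)] for an exponential variable [V] *)

Section exponential_law.
Context (R : realType).
Local Notation mu := (@lebesgue_measure R).

Lemma measurable_expRN_div (D : set R) : measurable D -> D `<=` `]0, +oo[ ->
  measurable_fun D (fun u : R => expR (- u) / u).
Proof.
move=> mD D0.
apply: (measurable_funS _ D0) => //.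
apply: open_continuous_measurable_fun => // x; rewrite inE/= in_itv/= andbT => x0.
apply: cvgM.
  by apply: continuous_comp; [exact: cvgN|exact: continuous_expR].
by apply: cvgV; [rewrite gt_eqF|].
Qed.

(** On the domain [1/u <= 1/x], and the exponential integrates exactly. The bound yields both the
    finiteness of [Ei] and its decay. *)
Lemma integral_expRN_div_le (x : R) : 0 < x ->
  (\int[mu]_(u in `[x, +oo[) (expR (- u) / u)%:E <= (x^-1 * expR (- x))%:E)%E.
Proof.
move=> x0.
apply: (@le_trans _ _ (\int[mu]_(u in `[x, +oo[) (x^-1 * expR (- u))%:E)%E).
  apply: ge0_le_integral => //=.
  - move=> u; rewrite in_itv/= andbT => xu.
    by rewrite lee_fin divr_ge0 ?expR_ge0// (le_trans (ltW x0)).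
  - apply/measurable_EFinP; apply: measurable_expRN_div => // u/=.
    by rewrite !in_itv/= !andbT; exact: lt_le_trans.
  - apply/measurable_EFinP; apply: measurable_funTS; apply: measurable_funM => //.
    by apply: measurableT_comp => //; exact: measurable_expR.
  - move=> u; rewrite in_itv/= andbT => xu; rewrite lee_fin mulrC.
    by rewrite ler_wpM2r ?expR_ge0// lef_pV2// posrE// (lt_le_trans x0).
rewrite (@ge0_continuous_FTC2y _ _ (fun u => - (x^-1 * expR (- u))) x (- (x^-1 * 0)))/=.
- by rewrite -EFinB lee_fin; lra.
- by move=> u _; rewrite mulr_ge0 ?expR_ge0// invr_ge0 ltW.
- apply: continuous_subspaceT => u; apply: cvgMl_tmp.
  by apply: continuous_comp; [exact: cvgN|exact: continuous_expR].
- by apply: cvgN; apply: cvgMl_tmp; exact: cvgr_expR.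
- by move=> u _; apply: ex_derive.
- apply: cvg_at_right_filter; apply: cvgN; apply: cvgMl_tmp.
  by apply: continuous_comp; [exact: cvgN|exact: continuous_expR].
- move=> u _; rewrite derive1E; apply: derive_val; apply: is_derive_eq.
  by rewrite /GRing.scale/=; ring.
Qed.

Lemma integral_expRN_div_lty (x : R) : 0 < x ->
  (\int[mu]_(u in `[x, +oo[) (expR (- u) / u)%:E < +oo)%E.
Proof.
by move=> x0; rewrite (le_lt_trans (integral_expRN_div_le x0))// ltry.
Qed.

(** [Ei] is a real-valued integral over an open ray; finiteness allows passing to the extended
    integral, and adding the endpoint changes nothing. *)
Lemma integral_expRN_div (x : R) : 0 < x ->
  (\int[mu]_(u in `[x, +oo[) (expR (- u) / u)%:E)%E = (- Ei (- x))%:E.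
Proof.
move=> x0; rewrite /Ei !opprK /Rintegral -integral_itv_obnd_cbnd.
  rewrite fineK// integral_itv_obnd_cbnd.
    rewrite ge0_fin_numE ?integral_expRN_div_lty//.
    apply: integral_ge0 => u/=; rewrite in_itv/= andbT => xu.
    by rewrite lee_fin divr_ge0 ?expR_ge0// (le_trans (ltW x0)).
  apply/measurable_EFinP; apply: measurable_expRN_div => // u/=.
  by rewrite !in_itv/= !andbT; exact: lt_trans.
apply/measurable_EFinP; apply: measurable_expRN_div => // u/=.
by rewrite !in_itv/= !andbT; exact: lt_trans.
Qed.

(** Under [r = ln u - ln x] one has [(e^r - 1) x = u - x] and [dr = du / u]; the constant [e^x] then
    comes out of the integral. *)
Lemma integral_expRN_expR (x : R) : 0 < x ->
  (\int[mu]_(r in `[0%R, +oo[) (expR (- ((expR r - 1) * x)))%:E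
   = (- Ei (- x) * expR x)%:E)%E.
Proof.
move=> x0; pose F (u : R) := ln u - ln x.
have dF (u : R) : 0 < u -> is_derive u 1 F u^-1.
  move=> u0; have := is_derive1_ln u0 => dln.
  by apply: is_derive_eq; rewrite subr0.
have F'E (u : R) : 0 < u -> derive1 F u = u^-1.
  by move=> u0; rewrite derive1E; have := dF _ u0 => ?; rewrite derive_val.
have Fx : F x = 0 by rewrite /F subrr.
have xy0 u : u \in `]x, +oo[ -> 0 < u.
  by rewrite in_itv/= andbT; exact: lt_trans.
have := @increasing_ge0_integration_by_substitutiony R F
  (fun r => expR (- ((expR r - 1) * x))) x.
rewrite Fx => ->.
- rewrite [in RHS]mulrC [in RHS]EFinM -[in RHS]integral_expRN_div//
    -[in RHS]ge0_integralZl//; last 2 first.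
  + apply/measurable_EFinP; apply: measurable_expRN_div => // u/=.
    by rewrite !in_itv/= !andbT; exact: lt_le_trans.
  + move=> u/=; rewrite in_itv/= andbT => xu.
    by rewrite lee_fin divr_ge0 ?expR_ge0// (le_trans (ltW x0)).
  apply: eq_integral => u; rewrite inE/= in_itv/= andbT => xu.
  have u0 : 0 < u := lt_le_trans x0 xu.
  rewrite -EFinM/= fctE/= F'E// mulrA -expRD; congr (expR _ / _)%:E.
  rewrite /F expRB !lnK ?posrE// mulrBl mul1r divfK ?gt_eqF//; ring.
- move=> u w; rewrite !in_itv/= !andbT => xu xw uw.
  by rewrite /F ltrD2r ltr_ln// posrE; apply: lt_le_trans; eassumption.
- move=> u xu; have u0 := xy0 _ xu.
  have : w^-1 @[w --> u] --> derive1 F u.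
    by rewrite F'E//; apply: cvgV; [rewrite gt_eqF|].
  apply: cvg_trans; apply: near_eq_cvg; near=> w; rewrite F'E//.
  by near: w; exact: lt_nbhsr.
- apply/cvg_ex; exists x^-1.
  have : w^-1 @[w --> x^'+] --> x^-1.
    by apply: cvg_at_right_filter; apply: cvgV; [rewrite gt_eqF|].
  apply: cvg_trans; apply: near_eq_cvg; near=> w; rewrite F'E//.
  by apply: lt_trans x0 _; near: w; exact: nbhs_right_gt.
- apply/cvg_ex; exists 0.
  have : (fun w : R => w^-1) @ +oo --> (0 : R).
    by apply/gtr0_cvgV0; [exact: nbhs_pinfty_gt|exact: cvg_id].
  by apply: cvg_trans; apply: near_eq_cvg; near=> w; rewrite F'E.
- split; first by move=> u xu; have ? := dF _ (xy0 _ xu); exact: ex_derive.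
  apply: cvg_at_right_filter; apply: cvgB; last exact: cvg_cst.
  exact: continuous_ln.
- apply/cvgryPge => A; near=> w.
  rewrite /F lerBrDr -[A + _]expRK ler_ln ?posrE ?expR_gt0//.
- apply: continuous_subspaceT => r; apply: continuous_comp; last exact: continuous_expR.
  apply: cvgN; apply: cvgMr_tmp; apply: cvgB; last exact: cvg_cst.
  exact: continuous_expR.
- by move=> r _; exact: expR_ge0.
Unshelve. all: by end_near. Qed.

(** The mean of a nonnegative variable is the integral of its tail. Here [ln (1 + a V) > r] means
    [V > (e^r - 1) / a], so the tail is the integrand of [integral_expRN_expR] at
    [x = 1 / (a v)]. *)
Lemma expectation_ln_exponential (d : measure_display) (T : measurableType d)
    (P : probability T R) (V : T -> R) (v a : R) :
  0 < v -> 0 < a -> measurable_fun setT V -> (forall w, 0 <= V w) ->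
  (forall z, 0 <= z -> P [set w | z < V w] = (expR (- (z / v)))%:E) ->
  ('E_P[fun w => ln (1 + a * V w)] =
    (- Ei (- (a * v)^-1) * expR ((a * v)^-1))%:E)%E.
Proof.
move=> v0 a0 mV V0 PV.
have mln : measurable_fun setT (fun w => ln (1 + a * V w)).
  apply: measurableT_comp => //.
  by apply: measurable_funD => //; exact: measurable_funM.
pose X : {RV P >-> R} := HB.pack (fun w => ln (1 + a * V w))
  (isMeasurableFun.Build _ _ _ _ _ mln).
have aV w : 0 < 1 + a * V w by rewrite ltr_wpDr// mulr_ge0 ?(ltW a0).
rewrite (@ge0_expectation_ccdf _ _ _ _ X)/=; last first.
  by move=> w; apply: ln_ge0; rewrite lerDl mulr_ge0 ?(ltW a0).
have av0 : 0 < (a * v)^-1 by rewrite invr_gt0 mulr_gt0.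
rewrite -(integral_expRN_expR av0).
apply: eq_integral => r; rewrite inE/= in_itv/= andbT => r0.
rewrite /ccdf /distribution /pushforward/=.
rewrite (_ : _ @^-1` _ = [set w | (expR r - 1) / a < V w]); last first.
  apply/seteqP; split => w/=; rewrite in_itv/= andbT ltr_pdivrMr// ltrBlDl;
  by rewrite [V w * a]mulrC -(ltr_expR r) lnK ?posrE.
rewrite PV; last by rewrite divr_ge0 ?(ltW a0)// subr_ge0 -expR0 ler_expR.
by congr (expR (- _))%:E; rewrite invfM mulrA.
Qed.

(** The variable is nonnegative, so its absolute moment is the finite mean just computed.
    Integrability is what linearity of the expectation asks for later. *)
Lemma Lfun1_ln_exponential (d : measure_display) (T : measurableType d)
    (P : probability T R) (V : T -> R) (v a : R) :
  0 < v -> 0 < a -> measurable_fun setT V -> (forall w, 0 <= V w) ->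
  (forall z, 0 <= z -> P [set w | z < V w] = (expR (- (z / v)))%:E) ->
  (fun w => ln (1 + a * V w)) \in Lfun P 1.
Proof.
move=> v0 a0 mV V0 PV; apply/Lfun1_integrable/integrableP; split.
  apply/measurable_EFinP; apply: measurableT_comp => //.
  by apply: measurable_funD => //; exact: measurable_funM.
have := expectation_ln_exponential v0 a0 mV V0 PV; rewrite unlock => E.
under eq_integral => w _.
  rewrite /= ger0_norm; last by apply: ln_ge0; rewrite lerDl mulr_ge0 ?(ltW a0).
  over.
by rewrite E ltry.
Qed.

End exponential_law.

(** * Behaviour of [Ei] near 0 and the Euler-Mascheroni constant *)

Section Ei_asymptotics.
Context (R : realType).
Local Notation mu := (@lebesgue_measure R).

(** With a base point [a = x/2] strictly between 0 and [x], [Ei (- y)] is near [x] a constant plus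
    the integral from [a] to [y], to which the fundamental theorem of calculus applies. *)
Lemma is_derive_EiN (x : R) : 0 < x ->
  is_derive x 1 (fun y : R => Ei (- y)) (expR (- x) / x).
Proof.
move=> x0; pose f (u : R) := expR (- u) / u; pose a := x / 2.
have a0 : 0 < a by rewrite divr_gt0.
have ax : a < x by rewrite /a; lra.
have intf : mu.-integrable `]a, +oo[ (EFin \o f).
  apply/integrableP; split.
    apply/measurable_EFinP; apply: measurable_expRN_div => // u/=.
    by rewrite !in_itv/= !andbT; exact: lt_trans.
  apply: le_lt_trans (integral_expRN_div_lty a0).
  rewrite -integral_itv_obnd_cbnd; last first.
    apply/measurable_EFinP; apply: measurable_expRN_div => // u/=.
    by rewrite !in_itv/= !andbT; exact: lt_trans.
  rewrite le_eqVlt; apply/orP; left; apply/eqP; apply: eq_integral => u.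
  rewrite inE/= in_itv/= andbT => au.
  by rewrite ger0_norm// divr_ge0 ?expR_ge0// ltW// (lt_trans a0).
have EiE y : a < y -> Ei (- y) = Ei (- a) + \int[mu]_(u in `]a, y]) f u.
  move=> ay; rewrite /Ei !opprK -(@Rintegral_itvB _ f (BRight a) (BInfty _ false) y)//.
    by rewrite opprB addrC.
  by rewrite bnd_simp ltW.
have cf : {for x, continuous f}.
  apply: cvgM; last by apply: cvgV; [rewrite gt_eqF|].
  by apply: continuous_comp; [exact: cvgN|exact: continuous_expR].
have [] := @continuous_FTC1 R f (BRight a) x (x + 1) _ _ _ cf.
- by rewrite ltrDl.
- by apply: integrableS intf => //; apply: subset_itvl.
- by rewrite lte_fin.
move=> dF F'E.
apply: (@near_eq_is_derive _ _ _
  (fun y : R => Ei (- a) + \int[mu]_(u in `]a, y]) f u)).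
  by near=> y; apply/esym/EiE; near: y; exact: lt_nbhsr.
rewrite -[expR _ / x]/(f x) -F'E -[derive1 _ _]add0r derive1E.
apply: is_deriveD.
exact: (DeriveDef dF).
Unshelve. all: by end_near. Qed.

Lemma EiN_ge0 (x : R) : 0 < x -> 0 <= - Ei (- x).
Proof.
move=> x0; rewrite -lee_fin -integral_expRN_div//; apply: integral_ge0 => u/=.
rewrite in_itv/= andbT => xu.
by rewrite lee_fin divr_ge0 ?expR_ge0// (le_trans (ltW x0)).
Qed.

(** For [c = 1/n] and [m = n] the sum is [K_n]. The term of index [k] has derivative
    [c (1 - x c)^k], and these form a geometric sum. *)
Lemma is_derive_truncated_log (c : R) (m : nat) (x : R) : x != 0 ->
  is_derive x 1 (fun y : R => \sum_(k < m) (1 - (1 - y * c) ^+ k.+1) / k.+1%:R)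
    ((1 - (1 - x * c) ^+ m) / x).
Proof.
move=> x0; elim: m => [|m IHm].
  rewrite expr0 subrr mul0r.
  rewrite (_ : (fun _ => _) = cst 0); first exact: is_derive_cst.
  by apply/funext => y; rewrite big_ord0.
have -> : (fun y : R => \sum_(k < m.+1) (1 - (1 - y * c) ^+ k.+1) / k.+1%:R) =
  (fun y : R => \sum_(k < m) (1 - (1 - y * c) ^+ k.+1) / k.+1%:R) +
  (fun y => (1 - (1 - y * c) ^+ m.+1) / m.+1%:R).
  by apply/funext => y; rewrite big_ord_recr.
have d1 : is_derive x 1 (fun y : R => 1 - y * c) (- c).
  by apply: is_derive_eq; rewrite /GRing.scale/=; ring.
have d2 : is_derive x 1 (fun y : R => (1 - (1 - y * c) ^+ m.+1) / m.+1%:R)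
    (c * (1 - x * c) ^+ m).
  have dB := is_deriveB (is_derive_cst (1 : R) x 1) (is_deriveX m.+1 d1).
  rewrite [X in is_derive _ _ X _](_ : _ = m.+1%:R^-1 \*:
      (cst 1 - (fun y : R => 1 - y * c) ^+ m.+1)); last first.
    by apply/funext => y /=; rewrite !fctE /GRing.scale/= mulrC.
  apply: (is_derive_eq (is_deriveZ _ dB)).
  by rewrite /GRing.scale/=; field; rewrite addrC natr1.
apply: (is_derive_eq (is_deriveD IHm d2)).
by rewrite exprS; field.
Qed.

(** Put [t = x/n]. The lower bound is the [n]-th power of [1 - t <= e^-t]. For the upper one,
    [(1 - t^2) e^-t <= 1 - t] is raised to the power [n], and Bernoulli's inequality bounds
    [(1 - t^2)^n] from below by [1 - n t^2]. *)
Lemma exp_sub_pow_bounds (n : nat) (x : R) : (0 < n)%N -> 0 <= x <= n%:R ->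
  0 <= expR (- x) - (1 - x / n%:R) ^+ n <= x ^+ 2 * expR (- x) / n%:R.
Proof.
move=> n0 /andP[x0 xn]; have n0' : 0 < n%:R :> R by rewrite ltr0n.
have t01 : 0 <= x / n%:R <= 1 by rewrite divr_ge0 ?ler0n//= ler_pdivrMr// mul1r.
set t := x / n%:R in t01 *; case/andP: t01 => t0 t1.
have exE : expR (- x) = expR (- t) ^+ n.
  by rewrite -expRM_natl; congr expR; rewrite /t; field; rewrite gt_eqF.
have q0 : 0 <= 1 - t by rewrite subr_ge0.
apply/andP; split.
  by rewrite subr_ge0 exE lerXn2r ?nnegrE ?expR_ge0// expR_ge1Dx.
(* Factor [1 - t^2] and use [1 + t <= e^t]. *)
have q1 : (1 - t ^+ 2) * expR (- t) <= 1 - t.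
  rewrite (_ : 1 - t ^+ 2 = (1 - t) * (1 + t)); last by ring.
  rewrite -mulrA ler_piMr// expRN ler_pdivrMr ?expR_gt0// mul1r.
  exact: expR_ge1Dx.
have bern m : 1 - m%:R * t ^+ 2 <= (1 - t ^+ 2) ^+ m.
  have t21 : 0 <= 1 - t ^+ 2 by rewrite subr_ge0 exprn_ile1.
  elim: m => [|m IHm]; first by rewrite mul0r subr0 expr0.
  rewrite [leRHS]exprS -natr1; apply: (le_trans _ (ler_wpM2l t21 IHm)).
  have : 0 <= m%:R * t ^+ 2 * t ^+ 2 by rewrite !mulr_ge0 ?sqr_ge0.
  nra.
have : (1 - n%:R * t ^+ 2) * expR (- x) <= (1 - t) ^+ n.
  apply: (@le_trans _ _ ((1 - t ^+ 2) ^+ n * expR (- x))).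
    by rewrite ler_wpM2r ?expR_ge0.
  rewrite exE -exprMn lerXn2r// nnegrE.
  by rewrite mulr_ge0 ?expR_ge0// subr_ge0 exprn_ile1.
have -> : x ^+ 2 * expR (- x) / n%:R = n%:R * t ^+ 2 * expR (- x).
  by rewrite /t; field; rewrite gt_eqF.
lra.
Qed.

Lemma EiN_ln_harmonic (n : nat) (x : R) : (0 < n)%N -> 0 < x <= n%:R ->
  - Ei (- n%:R) - (\sum_(k < n) k.+1%:R^-1 - ln n%:R)
  <= - Ei (- x) + ln x - \sum_(k < n) (1 - (1 - x / n%:R) ^+ k.+1) / k.+1%:R
  <= - Ei (- n%:R) - (\sum_(k < n) k.+1%:R^-1 - ln n%:R) + n%:R^-1.
Proof.
move=> n0 /andP[x0 xn]; set u := _ - ln n%:R; have n0' : 0 < n%:R :> R by rewrite ltr0n.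
pose H (y : R) := - Ei (- y) + ln y
  - \sum_(k < n) (1 - (1 - y * n%:R^-1) ^+ k.+1) / k.+1%:R.
(* [L] is an antiderivative of [- y e^-y / n], the lower bound for the derivative of [H]; hence [H]
   decreases while [H - L] increases. From [1 + y <= e^y] one gets [L <= 1/n]. *)
pose L (y : R) := (1 + y) * expR (- y) / n%:R.
(* At [y = n] every power has base 0, so the sum is the harmonic number. *)
have Hn : H n%:R = - Ei (- n%:R) - u.
  rewrite /H /u (_ : \sum_(k < n) _ = \sum_(k < n) k.+1%:R^-1); first by ring.
  by apply: eq_bigr => k _; rewrite divff ?gt_eqF// subrr exprS mul0r subr0 mul1r.
have dH (y : R) : 0 < y ->
    is_derive y 1 H (((1 - y / n%:R) ^+ n - expR (- y)) / y).
  move=> y0; have y0' : y != 0 by rewrite gt_eqF.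
  have dE := is_deriveN (is_derive_EiN y0).
  have dl := is_derive1_ln y0.
  have dK := is_derive_truncated_log n%:R^-1 n y0'.
  apply: (is_derive_eq (is_deriveB (is_deriveD dE dl) dK)).
  by field.
have dL (y : R) : is_derive y 1 L (- (y * expR (- y)) / n%:R).
  apply: is_derive_eq.
  by rewrite /GRing.scale/=; field; rewrite gt_eqF.
have cH y : 0 < y -> {for y, continuous H}.
  move=> y0; apply: differentiable_continuous; apply/derivable1_diffP.
  by have ? := dH _ y0; exact: ex_derive.
have cL y : {for y, continuous L}.
  by apply: differentiable_continuous; apply/derivable1_diffP; exact: ex_derive.
have xyP y : y \in `]x, n%:R[ -> 0 < y /\ 0 <= y <= n%:R.
  rewrite in_itv/= => /andP[xy yn]; split; first exact: lt_trans xy.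
  by rewrite !ltW// (lt_trans x0).
have H_decr : H n%:R <= H x.
  apply: (@ler0_derive1_le_cc _ H x n%:R) => //.
  - by move=> y /xyP[y0 _]; have ? := dH _ y0; exact: ex_derive.
  - move=> y /xyP[y0 yn]; rewrite derive1E; have ? := dH _ y0; rewrite derive_val.
    rewrite pmulr_lle0 ?invr_gt0//.
    have /andP[] := exp_sub_pow_bounds n0 yn; lra.
  - apply: continuous_in_subspaceT => y; rewrite inE/= in_itv/= => /andP[xy _].
    by apply: cH; exact: lt_le_trans xy.
  - by rewrite in_itv/= lexx andbT.
  - by rewrite in_itv/= lexx.
have HL_incr : H x - L x <= H n%:R - L n%:R.
  apply: (@ger0_derive1_le_cc _ (H - L) x n%:R) => //.
  - by move=> y /xyP[y0 _]; have ? := dH _ y0; exact: ex_derive.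
  - move=> y /xyP[y0 yn]; rewrite derive1E; have ? := dH _ y0; rewrite derive_val.
    have /andP[_] := exp_sub_pow_bounds n0 yn.
    set q := _ ^+ n; rewrite -subr_ge0 => q0.
    rewrite (_ : _ - _ = (y ^+ 2 * expR (- y) / n%:R - (expR (- y) - q)) / y).
      by rewrite divr_ge0// ltW.
    by field; rewrite !gt_eqF.
  - apply: continuous_in_subspaceT => y; rewrite inE/= in_itv/= => /andP[xy _].
    by apply: cvgB; [apply: cH; exact: lt_le_trans xy|exact: cL].
  - by rewrite in_itv/= lexx.
  - by rewrite in_itv/= lexx andbT.
have L0 : 0 <= L n%:R by rewrite /L !mulr_ge0 ?expR_ge0 ?invr_ge0 ?addr_ge0.
have L1 : L x <= n%:R^-1.
  rewrite /L ler_piMl ?invr_ge0 ?(ltW n0')// expRN ler_pdivrMr ?expR_gt0// mul1r.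
  exact: expR_ge1Dx.
rewrite -Hn -[X in _ <= X <= _]/(H x); apply/andP; split => //; lra.
Qed.

(* Bernoulli's inequality bounds the [k]-th term by [x / n]. *)
Lemma truncated_log_bounds (n : nat) (x : R) : (0 < n)%N -> 0 <= x <= n%:R ->
  0 <= \sum_(k < n) (1 - (1 - x / n%:R) ^+ k.+1) / k.+1%:R <= x.
Proof.
move=> n0 /andP[x0 xn]; have n0' : 0 < n%:R :> R by rewrite ltr0n.
have q0 : 0 <= 1 - x / n%:R by rewrite subr_ge0 ler_pdivrMr// mul1r.
have q1 : 1 - x / n%:R <= 1 by rewrite gerBl divr_ge0// ltW.
apply/andP; split.
  by apply: sumr_ge0 => k _; rewrite divr_ge0// subr_ge0 exprn_ile1.
rewrite -[leRHS](_ : \sum_(k < n) x / n%:R = x); last first.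
  by rewrite sumr_const card_ord -[LHS]mulr_natr divfK// gt_eqF.
apply: ler_sum => k _; rewrite ler_pdivrMr// -opprB lerNl -subr_ge0.
set t := x / n%:R in q0 q1 *.
elim: (nat_of_ord k).+1 => [|m IHm]; first by rewrite expr0; lra.
rewrite exprS -natr1; have := ler_wpM2l q0 IHm; rewrite mulr0.
have : 0 <= m%:R * t ^+ 2 by rewrite mulr_ge0 ?sqr_ge0.
nra.
Qed.

(** Eliminates [K_n(x)] from [EiN_ln_harmonic] through [0 <= K_n(x) <= x], and [Ei (- n)] from the
    lower bound through its sign. *)
Lemma EiN_ln_bounds (n : nat) (x : R) : (0 < n)%N -> 0 < x <= n%:R ->
  - (\sum_(k < n) k.+1%:R^-1 - ln n%:R) <= - Ei (- x) + ln x <=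
  - (\sum_(k < n) k.+1%:R^-1 - ln n%:R) - Ei (- n%:R) + n%:R^-1 + x.
Proof.
move=> n0 /[dup] x0n /EiN_ln_harmonic - /(_ n0) /andP[] + +.
have xn : 0 <= x <= n%:R by case/andP: x0n => x0 ->; rewrite ltW.
have /andP[] := truncated_log_bounds n0 xn.
have : 0 <= - Ei (- n%:R : R) by apply: EiN_ge0; rewrite ltr0n.
set D := \sum_(k < n) _ / _; move=> *; apply/andP; split; lra.
Qed.

Lemma EiN_le_inv (x : R) : 0 < x -> - Ei (- x) <= x^-1.
Proof.
move=> x0; rewrite -lee_fin -integral_expRN_div//.
apply: le_trans (integral_expRN_div_le x0) _; rewrite lee_fin ler_piMr ?invr_ge0 ?(ltW x0)//.
by rewrite -expR0 ler_expR oppr_le0 ltW.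
Qed.

(** The sequence decreases, its increment being [1/(n+2) + ln (1 - 1/(n+2)) <= 0], and
    [EiN_ln_bounds] at [x = 1] bounds it below by [Ei (- 1)]. Convergence makes the [limn] of the
    definition a genuine limit; the shift keeps [ln] away from 0. *)
Lemma cvg_euler_mascheroni :
  (\sum_(k < n.+1) k.+1%:R^-1 - ln n.+1%:R : R) @[n --> \oo]
    --> euler_mascheroni R.
Proof.
pose u (n : nat) : R := \sum_(1 <= k < n.+1) k%:R^-1 - ln n%:R.
have uE n : u n.+1 = \sum_(k < n.+1) k.+1%:R^-1 - ln n.+1%:R.
  by rewrite /u big_add1/= big_mkord.
suff cu : cvgn (fun n => u n.+1).
  under eq_fun do rewrite -uE.
  have /cvg_ex[l ul] := cu.
  rewrite /euler_mascheroni -/u.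
  have ul' : u @ \oo --> l by rewrite -cvg_shiftS.
  by rewrite (cvg_lim _ ul').
apply: nonincreasing_is_cvgn.
  apply/nonincreasing_seqP => n; rewrite !uE big_ord_recr/=.
  have n1 : 0 < n.+1%:R :> R by [].
  have n2 : 0 < n.+2%:R :> R by [].
  have : ln (1 + (- n.+2%:R^-1)) <= - n.+2%:R^-1 :> R.
    by apply: le_ln1Dx; rewrite ltrN2 invf_lt1// ltr1n.
  rewrite (_ : 1 + _ = n.+1%:R / n.+2%:R); last first.
    have -> : n.+1%:R = n.+2%:R - 1 :> R by rewrite -(natr1 n.+1) addrK.
    by field; rewrite gt_eqF.
  rewrite ln_div ?posrE//.
  by move: (ln n.+1%:R) (ln n.+2%:R) (n.+2%:R^-1) (\sum_(_ < _) _) => *; lra.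
exists (Ei (- 1)) => _ [n _ <-]; rewrite uE.
have n1 : 0 < (1 : R) <= n.+1%:R by rewrite ltr01 ler1n.
by have /andP[+ _] := EiN_ln_bounds (ltn0Sn n) n1; rewrite ln1 addr0 lerN2.
Qed.

(** [EiN_ln_bounds] is read at fixed [x] as [n] tends to infinity. *)
Lemma Ei_ln_euler (x : R) : 0 < x ->
  - x <= Ei (- x) - ln x - euler_mascheroni R <= 0.
Proof.
move=> x0; have cu := cvg_euler_mascheroni.
have xn : \forall n \near \oo, x <= n.+1%:R.
  near=> n; rewrite (@le_trans _ _ n%:R)// ?ler_nat//.
  by near: n; exact: nbhs_infty_ger.
have lb : Ei (- x) - ln x <= euler_mascheroni R.
  apply: (cvgr_to_ge cu); near=> n.
  have xn1 : 0 < x <= n.+1%:R by rewrite x0; near: n.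
  have /andP[] := EiN_ln_bounds (ltn0Sn n) xn1; lra.
(* The error [- Ei (- m) + 1/m] with [m = n + 1] is at most [2/m], and [harmonic n] is [1/(n+1)]. *)
have cv : (\sum_(k < n.+1) k.+1%:R^-1 - ln n.+1%:R - 2 * harmonic n : R)
    @[n --> \oo] --> euler_mascheroni R.
  rewrite -[X in _ --> X]subr0 -[X in _ - X](mulr0 2).
  by apply: cvgB => //; apply: cvgMl_tmp; exact: cvg_harmonic.
have ub : euler_mascheroni R <= Ei (- x) - ln x + x.
  apply: (cvgr_to_le cv); near=> n.
  have xn1 : 0 < x <= n.+1%:R by rewrite x0; near: n.
  have /andP[_] := EiN_ln_bounds (ltn0Sn n) xn1.
  have := @EiN_le_inv n.+1%:R (ltr0Sn _ _).
  rewrite /harmonic/=.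
  by move: (Ei (- n.+1%:R)) (n.+1%:R^-1) (_ - ln n.+1%:R) => *; lra.
apply/andP; split; lra.
Unshelve. all: by end_near. Qed.

End Ei_asymptotics.

(** * Vanishing remainder of [Ei (- x) e^x] as [x] tends to 0 *)

Section high_snr.
Context (R : realType).

(** The factor [e^x] contributes the extra terms [(e^x - 1) ln x] and [(e^x - 1) gamma]. Since
    [e^x - 1 <= x e^x] and [|ln x| <= 2 / sqrt x], they vanish with [x]. *)
Lemma Ei_exp_bound (x : R) : 0 < x < 1 ->
  `|Ei (- x) * expR x - ln x - euler_mascheroni R| <=
  expR x * (x + 2 * Num.sqrt x + x * `|euler_mascheroni R|).
Proof.
move=> /andP[x0 x1]; set g := euler_mascheroni R.
have /andP[A1 A0] := Ei_ln_euler x0; rewrite -/g in A1 A0.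
set A := Ei (- x) - ln x - g in A1 A0.
have -> : Ei (- x) * expR x - ln x - g =
    expR x * A + ((expR x - 1) * ln x + (expR x - 1) * g).
  by rewrite /A; ring.
have e0 := expR_gt0 x.
have e1 : 0 <= expR x - 1 by rewrite subr_ge0 -expR0 ler_expR ltW.
have e2 : expR x - 1 <= expR x * x.
  have := expR_ge1Dx (- x); rewrite expRN => h.
  have := ler_wpM2l (ltW e0) h; rewrite divff ?gt_eqF//; lra.
have s0 : 0 < Num.sqrt x by rewrite sqrtr_gt0.
have sx : Num.sqrt x ^+ 2 = x by rewrite sqr_sqrtr// ltW.
(* Apply [ln u < u] to [u = 1 / sqrt x], whose logarithm is [- ln x / 2]. *)
have lnx : `|ln x| <= 2 * (Num.sqrt x)^-1.
  rewrite ler0_norm; last by rewrite ln_le0// ltW.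
  rewrite -lnV ?posrE// -{1}sx -exprVn lnXn ?invr_gt0// -[leLHS]mulr_natl.
  by rewrite ler_wpM2l// ltW// ln_sublinear// invr_gt0.
rewrite [leRHS](_ : _ = expR x * x +
  (expR x * (2 * Num.sqrt x) + expR x * (x * `|g|))); last by ring.
apply: le_trans (ler_normD _ _) _; apply: lerD.
  by rewrite normrM (gtr0_norm e0) ler_wpM2l ?(ltW e0)// ler0_norm// lerNl.
apply: le_trans (ler_normD _ _) _; apply: lerD; rewrite normrM (ger0_norm e1).
  apply: (le_trans (ler_pM e1 (normr_ge0 _) e2 lnx)).
  have xs : x * (Num.sqrt x)^-1 = Num.sqrt x.
    by rewrite -{1}sx expr2 mulfK// gt_eqF.
  by rewrite -mulrA [x * (2 * _)]mulrCA xs.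
by rewrite mulrA ler_wpM2r.
Qed.

Lemma cvg_Ei_exp (s : R) : 0 < s ->
  (Ei (- (s / p)) * expR (s / p) - (ln s - ln p) - euler_mascheroni R)
    @[p --> +oo] --> (0 : R).
Proof.
move=> s0; pose g := euler_mascheroni R.
have sp0 : (s / p) @[p --> +oo] --> (0 : R).
  rewrite -(mulr0 s); apply: cvgMl_tmp.
  by apply/gtr0_cvgV0; [exact: nbhs_pinfty_gt|exact: cvg_id].
pose B (x : R) := expR x * (x + 2 * Num.sqrt x + x * `|g|).
have B0 : B x @[x --> 0] --> (0 : R).
  rewrite [X in _ --> X](_ : _ = B 0); last first.
    by rewrite /B sqrtr0 mulr0 mul0r !addr0 mulr0.
  apply: cvgM; first exact: continuous_expR.
  apply: cvgD; last by apply: cvgMr_tmp; exact: cvg_id.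
  apply: cvgD; first exact: cvg_id.
  by apply: cvgMl_tmp; exact: sqrt_continuous.
have Bp : B (s / p) @[p --> +oo] --> (0 : R) := cvg_comp _ _ sp0 B0.
apply: (@squeeze_cvgr _ _ _ _ (fun p => - B (s / p)) (fun p => B (s / p))) => //.
  near=> p.
  have p0 : 0 < p by near: p; exact: nbhs_pinfty_gt.
  (* This puts [s / p] below 1, as [Ei_exp_bound] requires. *)
  have sp : s < p by near: p; apply: nbhs_pinfty_gt; exact: num_real.
  rewrite -ler_norml -ln_div ?posrE//; apply: Ei_exp_bound.
  by rewrite divr_gt0// ltr_pdivrMr// mul1r.
by rewrite -oppr0; apply: cvgN.
Unshelve. all: by end_near. Qed.

End high_snr.

(** * Mean logarithms of the near and far channel gains *)

Section ergodic_rates.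
Context (R : realType) (d : measure_display) (T : measurableType d).
Context (P : probability T R).
Variables (h1 h2 hN hF : T -> R[i]) (v1 v2 a : R).
Hypotheses (v10 : 0 < v1) (v20 : 0 < v2) (a0 : 0 < a).
Hypotheses (hv1 : complex_gaussian P h1 v1) (hv2 : complex_gaussian P h2 v2).
Hypothesis ind : independent_rv P (coords h1) (coords h2).
Hypothesis hN_max : forall w,
  Normc.normc (hN w) = Num.max (Normc.normc (h1 w)) (Normc.normc (h2 w)).
Hypothesis hF_min : forall w,
  Normc.normc (hF w) = Num.min (Normc.normc (h1 w)) (Normc.normc (h2 w)).

Let v3 := v1 * v2 / (v1 + v2).
(** The gain [a] stays free because the far rate uses two values of it, with and without the factor
    [alphaN]. *)
Let lnpow (h : T -> R[i]) (w : T) := ln (1 + a * Normc.normc (h w) ^+ 2).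

Lemma normc_ge0 (x : R[i]) : 0 <= Normc.normc x.
Proof. by case: x => r i; exact: sqrtr_ge0. Qed.

Lemma far_power w : Normc.normc (hF w) ^+ 2 =
  Num.min (Normc.normc (h1 w) ^+ 2) (Normc.normc (h2 w) ^+ 2).
Proof.
rewrite hF_min; have n1 := normc_ge0 (h1 w); have n2 := normc_ge0 (h2 w).
case: (leP (Normc.normc (h1 w)) (Normc.normc (h2 w))) => h12.
  by rewrite min_l// lerXn2r.
by rewrite min_r// lerXn2r// ltW.
Qed.

(** At each outcome the near and far powers are those of [h1] and [h2] in some order. The law of the
    maximum is thereby never computed. *)
Lemma ln_near_power w : lnpow hN w = lnpow h1 w + lnpow h2 w - lnpow hF w.
Proof.
rewrite /lnpow hN_max hF_min.
by case: (leP (Normc.normc (h1 w)) (Normc.normc (h2 w))) => h12; ring.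
Qed.

Lemma far_mean_gt0 : 0 < v3. Proof. by rewrite divr_gt0 ?mulr_gt0 ?addr_gt0. Qed.

Lemma measurable_far_power : measurable_fun setT (fun w => Normc.normc (hF w) ^+ 2).
Proof.
under eq_fun do rewrite far_power.
by apply: measurable_minr;
  [exact: measurable_normc_sqr hv1|exact: measurable_normc_sqr hv2].
Qed.

Lemma far_power_tail z : 0 <= z ->
  P [set w | z < Normc.normc (hF w) ^+ 2] = (expR (- (z / v3)))%:E.
Proof.
move=> z0; rewrite -(complex_gaussian_tail_min hv1 hv2 ind)//.
by congr (P _); apply/seteqP; split => w/=; rewrite far_power.
Qed.

Lemma expectation_ln_far :
  'E_P[lnpow hF]%E = (- Ei (- (a * v3)^-1) * expR ((a * v3)^-1))%:E.
Proof.
apply: expectation_ln_exponential => //;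
  [exact: far_mean_gt0|exact: measurable_far_power| |exact: far_power_tail].
by move=> w; exact: sqr_ge0.
Qed.

Lemma Lfun1_ln_far : lnpow hF \in Lfun P 1.
Proof.
apply: (@Lfun1_ln_exponential _ _ _ _ _ v3) => //;
  [exact: far_mean_gt0|exact: measurable_far_power| |exact: far_power_tail].
by move=> w; exact: sqr_ge0.
Qed.

Lemma expectation_ln_gaussian (h : T -> R[i]) (v : R) :
  complex_gaussian P h v -> 0 < v ->
  'E_P[lnpow h]%E = (- Ei (- (a * v)^-1) * expR ((a * v)^-1))%:E.
Proof.
move=> hv v0; apply: expectation_ln_exponential => //.
- exact: measurable_normc_sqr hv.
- by move=> w; exact: sqr_ge0.
- by move=> z z0; exact: complex_gaussian_tail.
Qed.

Lemma Lfun1_ln_gaussian (h : T -> R[i]) (v : R) :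
  complex_gaussian P h v -> 0 < v -> lnpow h \in Lfun P 1.
Proof.
move=> hv v0; apply: (@Lfun1_ln_exponential _ _ _ _ _ v) => //.
- exact: measurable_normc_sqr hv.
- by move=> w; exact: sqr_ge0.
- by move=> z z0; exact: complex_gaussian_tail.
Qed.

Lemma expectation_ln_near :
  'E_P[lnpow hN]%E = (- Ei (- (a * v1)^-1) * expR ((a * v1)^-1)
    - Ei (- (a * v2)^-1) * expR ((a * v2)^-1)
    + Ei (- (a * v3)^-1) * expR ((a * v3)^-1))%:E.
Proof.
have i1 := Lfun1_ln_gaussian hv1 v10.
have i2 := Lfun1_ln_gaussian hv2 v20.
rewrite (_ : lnpow hN = (lnpow h1 \+ lnpow h2) \- lnpow hF); last first.
  by apply/funext => w; exact: ln_near_power.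
rewrite expectationB ?Lfun1_ln_far ?rpredD//.
rewrite expectationD// (expectation_ln_gaussian hv1)// (expectation_ln_gaussian hv2)//.
rewrite expectation_ln_far -!EFinD; congr EFin; ring.
Qed.

Lemma Lfun1_ln_near : lnpow hN \in Lfun P 1.
Proof.
rewrite (_ : lnpow hN = lnpow h1 + lnpow h2 - lnpow hF); last first.
  by apply/funext => w; exact: ln_near_power.
by rewrite rpredB ?Lfun1_ln_far// rpredD// (Lfun1_ln_gaussian hv1, Lfun1_ln_gaussian hv2).
Qed.

End ergodic_rates.

(** * Closed forms and high-SNR limits of the two rates *)

Theorem theorem2 (R : realType) (d : measure_display) (T : measurableType d)
    (P : probability T R) (h1 h2 hN hF : T -> R[i])
    (rho1 rho2 alphaN alphaF sigma2 kappa mu : R) (t : scheme)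
    (rho1_gt0 : 0 < rho1) (rho2_gt0 : 0 < rho2)
    (h1_law : complex_gaussian P h1 rho1)
    (h2_law : complex_gaussian P h2 rho2)
    (h12_indep : independent_rv P (coords h1) (coords h2))
    (hN_max : forall w, Normc.normc (hN w) = Num.max (Normc.normc (h1 w)) (Normc.normc (h2 w)))
    (hF_min : forall w, Normc.normc (hF w) = Num.min (Normc.normc (h1 w)) (Normc.normc (h2 w)))
    (sigma2_gt0 : 0 < sigma2)
    (alphaN_gt0 : 0 < alphaN) (alpha_sum : alphaN + alphaF = 1)
    (alpha_lt : alphaN < alphaF)
    (kappa_01 : 0 <= kappa <= 1) (mu_01 : 0 <= mu <= 1)
    (mu_t_neq0 : mu_of mu t != 0) :
  let rho3 := rho1 * rho2 / (rho1 + rho2) in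
  let kt := kappa_of kappa t in
  let mt := mu_of mu t in
  let RN := rate_near kt mt sigma2 P alphaN hN in
  let RF := rate_far kt mt sigma2 P alphaN alphaF hF in
  let psi_t := psi kt mt sigma2 alphaN in
  let chi3 := chi kt mt sigma2 rho3 in
  [/\ forall p : R, 0 < p ->
        RN p = (kt / ln 2 * (psi_t p rho3 - psi_t p rho2 - psi_t p rho1))%:E,
      forall p : R, 0 < p ->
        RF p = (kt / ln 2 * psi_t p rho3
                - kt / ln 2 * Ei (- chi3 / p) * expR (chi3 / p))%:E,
      (RN p - (kt * log2 p - kt * euler_mascheroni R / ln 2
               - kt * log2 (kt * sigma2 / (mt * alphaN * (rho1 + rho2))))%:E)%E
        @[p --> +oo] --> 0%E
    & (RF p - (- kt * log2 alphaN)%:E)%E @[p --> +oo] --> 0%E].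
Proof.
move=> rho3 kt mt RN RF psi_t chi3.
have rho3_gt0 : 0 < rho3 by rewrite divr_gt0 ?mulr_gt0 ?addr_gt0.
have mt_gt0 : 0 < mt.
  rewrite lt0r mu_t_neq0 /mt; case: (t) => //=.
  by case/andP: mu_01.
have kt_ge0 : 0 <= kt by rewrite /kt; case: (t) => //=; case/andP: kappa_01.
(* The general argument divides by [kt]. When [kt = 0], the prefactor makes both rates and all four
   right-hand sides vanish. *)
have [kt0|kt_neq0] := eqVneq kt 0.
  have RN0 p : RN p = 0%E.
    rewrite /RN /rate_near kt0 (_ : (fun _ => _) = cst 0) ?expectation_cst//.
    by apply/funext => w; rewrite mul0r.
  have RF0 p : RF p = 0%E.
    rewrite /RF /rate_far kt0 (_ : (fun _ => _) = cst 0) ?expectation_cst//.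
    by apply/funext => w; rewrite mul0r.
  split.
  - by move=> p _; rewrite RN0 kt0 !mul0r.
  - by move=> p _; rewrite RF0 kt0 !mul0r subrr.
  - under eq_fun do rewrite RN0 kt0 !mul0r !subrr sube0.
    exact: cvg_cst.
  - under eq_fun do rewrite RF0 kt0 oppr0 mul0r sube0.
    exact: cvg_cst.
have kt_gt0 : 0 < kt by rewrite lt0r kt_neq0.
have ln2_gt0 : 0 < ln 2 :> R by rewrite ln_gt0// ltr1n.
have alphaF_gt0 : 0 < alphaF by exact: lt_trans alpha_lt.
have chi_gt0 rho : 0 < rho -> 0 < chi kt mt sigma2 rho.
  by move=> rho_gt0; rewrite divr_gt0 ?mulr_gt0.
pose gain p := mt * p / (kt * sigma2).
have gain_gt0 p : 0 < p -> 0 < gain p by move=> p0; rewrite divr_gt0 ?mulr_gt0.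
have gainV p rho : 0 < p -> 0 < rho -> (gain p * rho)^-1 = chi kt mt sigma2 rho / p.
  move=> p0 r0; rewrite /gain /chi; field.
  by rewrite !gt_eqF.
have gainNV p rho : 0 < p -> 0 < rho ->
    (gain p * alphaN * rho)^-1 = chi kt mt sigma2 rho / (alphaN * p).
  move=> p0 r0; rewrite /gain /chi; field.
  by rewrite !gt_eqF.
have RNE p : 0 < p ->
    RN p = (kt / ln 2 * (psi_t p rho3 - psi_t p rho2 - psi_t p rho1))%:E.
  move=> p0; have a0 : 0 < gain p * alphaN by rewrite mulr_gt0 ?gain_gt0.
  rewrite /RN /rate_near (_ : (fun _ => _) = (kt / ln 2) \o*
      (fun w => ln (1 + gain p * alphaN * Normc.normc (hN w) ^+ 2))); last first.
    apply/funext => w /=; rewrite /log2 /snr_near mulrA mulrAC [RHS]mulrC.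
    congr (_ * ln (1 + _)).
    by rewrite /gain; field; rewrite !gt_eqF.
  rewrite expectationZl; last exact: (Lfun1_ln_near rho1_gt0 rho2_gt0 a0 h1_law h2_law).
  rewrite (expectation_ln_near rho1_gt0 rho2_gt0 a0 h1_law h2_law h12_indep hN_max hF_min).
  rewrite -EFinM; congr EFin; rewrite !gainNV// /psi_t /psi; ring.
have RFE p : 0 < p ->
    RF p = (kt / ln 2 * psi_t p rho3
            - kt / ln 2 * Ei (- chi3 / p) * expR (chi3 / p))%:E.
  move=> p0; have a0 : 0 < gain p * alphaN by rewrite mulr_gt0 ?gain_gt0.
  (* Since [alphaF = 1 - alphaN], one plus the far SINR is the quotient of [1 + gain p |hF|^2] by
     [1 + gain p alphaN |hF|^2], and its logarithm splits into two terms of the same kind. *)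
  rewrite /RF /rate_far (_ : (fun _ => _) = (kt / ln 2) \o*
      ((fun w => ln (1 + gain p * Normc.normc (hF w) ^+ 2)) \-
       (fun w => ln (1 + gain p * alphaN * Normc.normc (hF w) ^+ 2)))); last first.
    apply/funext => w /=; rewrite /log2 /sinr_far mulrA mulrAC [RHS]mulrC.
    have n0 : 0 <= Normc.normc (hF w) ^+ 2 := sqr_ge0 _.
    have b1 : 0 < 1 + gain p * Normc.normc (hF w) ^+ 2.
      by rewrite ltr_wpDr// mulr_ge0// ltW// gain_gt0.
    have a1 : 0 < 1 + gain p * alphaN * Normc.normc (hF w) ^+ 2.
      by rewrite ltr_wpDr// mulr_ge0// ltW.
    rewrite -ln_div ?posrE//; congr (_ * ln _).
    have d0 : 0 < kt * sigma2 + mt * p * Normc.normc (hF w) ^+ 2 * alphaN.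
      rewrite ltr_wpDr ?mulr_gt0// mulr_ge0 ?(ltW alphaN_gt0)//.
      by rewrite mulr_ge0// mulr_ge0// ltW.
    rewrite (_ : alphaF = 1 - alphaN); last by rewrite -alpha_sum addrAC subrr add0r.
    move: a1; rewrite /gain => a1; field.
    by rewrite !gt_eqF// [mt * p * alphaN * _]mulrAC.
  have b0 := gain_gt0 _ p0.
  rewrite expectationZl; last first.
    by rewrite rpredB//; [exact: (Lfun1_ln_far rho1_gt0 rho2_gt0 b0 h1_law h2_law)
                       |exact: (Lfun1_ln_far rho1_gt0 rho2_gt0 a0 h1_law h2_law)].
  rewrite expectationB; last 2 first.
  - exact: (Lfun1_ln_far rho1_gt0 rho2_gt0 b0 h1_law h2_law).
  - exact: (Lfun1_ln_far rho1_gt0 rho2_gt0 a0 h1_law h2_law).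
  rewrite (expectation_ln_far rho1_gt0 rho2_gt0 b0 h1_law h2_law h12_indep hF_min).
  rewrite (expectation_ln_far rho1_gt0 rho2_gt0 a0 h1_law h2_law h12_indep hF_min).
  rewrite -EFinB -EFinM; congr EFin; rewrite gainNV// gainV// /psi_t /psi (mulNr chi3) /chi3; ring.
(* The error in [Ei(-s/p) e^(s/p) ~ ln s - ln p + gamma], which tends to 0 by [cvg_Ei_exp]. *)
pose rem (s p : R) :=
  Ei (- (s / p)) * expR (s / p) - (ln s - ln p) - euler_mascheroni R.
have psiE p rho : 0 < p -> 0 < rho ->
    psi_t p rho = rem (chi kt mt sigma2 rho / alphaN) p
      + (ln (chi kt mt sigma2 rho) - ln alphaN - ln p) + euler_mascheroni R.
  move=> p0 r0; rewrite /rem ln_div ?posrE ?chi_gt0//.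
  rewrite /psi_t /psi invfM mulrA; ring.
have lnchi rho : 0 < rho -> ln (chi kt mt sigma2 rho) = ln (kt * sigma2 / mt) - ln rho.
  move=> r0; rewrite -ln_div ?posrE ?divr_gt0 ?mulr_gt0//; congr ln.
  by rewrite /chi; field; rewrite !gt_eqF.
have cvg_rem rho : 0 < rho ->
    rem (chi kt mt sigma2 rho / alphaN) p @[p --> +oo] --> (0 : R).
  by move=> r0; apply: cvg_Ei_exp; rewrite divr_gt0 ?chi_gt0.
(* Transfers a real limit to an extended-real function known only for [p > 0], where the closed
   forms hold. *)
have cvg_EFin0 (f : R -> R) (g : R -> \bar R) :
    f p @[p --> +oo] --> (0 : R) -> (forall p, 0 < p -> g p = (f p)%:E) ->
    g p @[p --> +oo] --> 0%E.
  move=> f0 gf.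
  have : (f p)%:E @[p --> +oo] --> (0 : R)%:E.
    by apply: cvg_EFin; [exact: nearW|].
  apply: cvg_trans; apply: near_eq_cvg; near=> p.
  by rewrite gf.
split => //.
(* With signs [+, -, -] the main parts of the three [psi] terms leave one [ln p] and one [- gamma],
   and [ln rho1 + ln rho2 - ln rho3] is [ln (rho1 + rho2)]. *)
- apply: (cvg_EFin0 (fun p => kt / ln 2 *
    (rem (chi kt mt sigma2 rho3 / alphaN) p - rem (chi kt mt sigma2 rho2 / alphaN) p
     - rem (chi kt mt sigma2 rho1 / alphaN) p))).
    rewrite -(mulr0 (kt / ln 2)); apply: cvgMl_tmp.
    rewrite -[X in _ --> X](subr0 (0 : R)) -[X in _ --> X - _](subr0 (0 : R)).
    by apply: cvgB; [apply: cvgB|]; exact: cvg_rem.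
  move=> p p0; rewrite RNE// -EFinB; congr EFin.
  rewrite !psiE// !lnchi// /log2.
  have -> : ln rho3 = ln rho1 + ln rho2 - ln (rho1 + rho2).
    by rewrite ln_div ?posrE ?lnM ?mulr_gt0 ?addr_gt0.
  have -> : ln (kt * sigma2 / (mt * alphaN * (rho1 + rho2))) =
      ln (kt * sigma2 / mt) - ln alphaN - ln (rho1 + rho2).
    rewrite -!ln_div ?posrE ?divr_gt0 ?mulr_gt0 ?addr_gt0//; congr ln.
    by field; rewrite !gt_eqF ?addr_gt0.
  by field; rewrite gt_eqF.
(* Both terms involve [chi3], so [ln p], [gamma] and [ln chi3] cancel and only [- ln alphaN]
   remains. *)
- apply: (cvg_EFin0 (fun p => kt / ln 2 *
    (rem (chi kt mt sigma2 rho3 / alphaN) p - rem chi3 p))).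
    rewrite -(mulr0 (kt / ln 2)); apply: cvgMl_tmp.
    rewrite -[X in _ --> X](subr0 (0 : R)).
    by apply: cvgB; [exact: cvg_rem|apply: cvg_Ei_exp; exact: chi_gt0].
  move=> p p0; rewrite RFE// -EFinB; congr EFin.
  rewrite psiE// /rem /log2 (mulNr chi3) -/chi3.
  by field; rewrite gt_eqF.
Unshelve. all: by end_near. Qed.
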